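(* Let $n,m_1,m_2$ be nonnegative integers. Let $C_1(m_1,m_2,n)$ be the number of partitions of $n$ into parts congruent to $0,1,3,$ or $5\pmod 6$ with exactly $m_1$ parts congruent to $1\pmod 6$ and exactly $m_2$ parts congruent to $5\pmod 6$. Let $C_2(m_1,m_2,n)$ be the number of partitions of $n$ satisfying: (a) if two adjacent parts differ by exactly $1$, the smaller is not $\equiv1\pmod3$; (b) if two adjacent parts differ by exactly $2$, the smaller is $\equiv2\pmod3$; (c) no part equals $2$; (d) there are exactly $m_1$ parts congruent to $1\pmod 3$ and exactly $m_2$ parts congruent to $2\pmod 3$. Then $C_1(m_1,m_2,n)=C_2(m_1,m_2,n)$.
   Context: Partitions are written in nonincreasing order; ''adjacent parts'' means $\lambda_j$ and $\lambda_{j+1}$ in that ordering. Numbers of parts in a residue class are counted with multiplicity. *)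

(* Defs.v *)
From mathcomp Require Import all_boot.
Set Implicit Arguments. Unset Strict Implicit. Unset Printing Implicit Defensive.

Definition is_partition (n : nat) (s : seq nat) : bool :=
  [&& sorted (fun a b => b <= a) s, all (fun x => 0 < x) s & sumn s == n].

(* Number of partitions of n satisfying P.  Every partition of n has at most
   n parts, each at most n, so it is the value-sequence of exactly one k-tuple
   of elements of 'I_n.+1 with k <= n. *)
Definition npart (P : seq nat -> bool) (n : nat) : nat :=
  \sum_(k < n.+1)
     #|[set t : k.-tuple 'I_n.+1 |
          is_partition n (map (@nat_of_ord _) t) && P (map (@nat_of_ord _) t)]|.

Definition C1_pred (m1 m2 : nat) (s : seq nat) : bool :=
  [&& all (fun x => x %% 6 \in [:: 0; 1; 3; 5]) s,
      count (fun x => x %% 6 == 1) s == m1 &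
      count (fun x => x %% 6 == 5) s == m2].

Definition adj_ok (a b : nat) : bool :=
  ((a == b + 1) ==> (b %% 3 != 1)) && ((a == b + 2) ==> (b %% 3 == 2)).

Definition C2_pred (m1 m2 : nat) (s : seq nat) : bool :=
  [&& sorted adj_ok s, 2 \notin s,
      count (fun x => x %% 3 == 1) s == m1 &
      count (fun x => x %% 3 == 2) s == m2].

Definition C1 (m1 m2 n : nat) : nat := npart (C1_pred m1 m2) n.
Definition C2 (m1 m2 n : nat) : nat := npart (C2_pred m1 m2) n.

(* Main.v *)
(* Put Q = q^3 and let x, y mark the parts congruent to 1, 2 mod 3.  Pad the
   partitions by zeros and read them in nondecreasing order, so that both sides
   count walks of a fixed length L.  Splitting off the first step, and
   translating what remains, gives for the C2 adjacency condition, with starting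
   points 0, 1, 5, the recurrence
     T_a(L+1) = Q^(L+1) T_a(L+1) + sum_(b in heads a) wt(b) T_b(L);
   the nondecreasing sequences H of numbers congruent to 0, 1, 5 mod 6 satisfy
   the same recurrence with Q^(2L+2) in place of Q^(L+1).  Hence
     T_a(L) = (1 + Q)(1 + Q^2)...(1 + Q^L) H_a(L).
   As L grows, the factor (1 + Q^m) / (1 - Q^(2m)) = 1 / (1 - Q^m) successively
   replaces the part 6m by the part 3m, which leaves all parts congruent to
   0, 1, 3, 5 mod 6. *)
Require Import Defs.
From mathcomp Require Import all_boot.
From mathcomp Require Import zify.
Set Implicit Arguments. Unset Strict Implicit. Unset Printing Implicit Defensive.

(* f i j n is the coefficient of x^i y^j q^n. *)
Definition series := nat -> nat -> nat -> nat.

Definition shift (a b c : nat) (f : series) : series := fun i j n =>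
  if [&& a <= i, b <= j & c <= n] then f (i - a) (j - b) (n - c) else 0.

(* Multiplication by the weight of one part v: q^v, x q^v or y q^v. *)
Definition wshift (v : nat) : series -> series := shift (v %% 3 == 1) (v %% 3 == 2) v.

(* The starting point a of a walk carries no weight. *)
Fixpoint walks (r : rel nat) (L a : nat) : series := fun i j n =>
  if L is L'.+1 then \sum_(0 <= k < n.+1 | r a k) wshift k (walks r L' k) i j n
  else [&& i == 0, j == 0 & n == 0].

(** * Shifts of series and their effect on walks *)

Lemma eq_shift a b c (f g : series) i j n :
    (forall i j m, m + c <= n -> f i j m = g i j m) ->
  shift a b c f i j n = shift a b c g i j n.
Proof. by rewrite /shift => fg; case: and3P => // -[_ _ le_cn]; rewrite fg ?subnK. Qed.

Lemma shift0 (f : series) i j n : shift 0 0 0 f i j n = f i j n.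
Proof. by rewrite /shift !leq0n !subn0. Qed.

Lemma shift_shift a b c a' b' c' (f : series) i j n :
  shift a b c (shift a' b' c' f) i j n = shift (a + a') (b + b') (c + c') f i j n.
Proof.
rewrite /shift !subnDA.
case: (boolP [&& a <= i, b <= j & c <= n]) => [/and3P[ha hb hc] | h].
  by rewrite -!(leq_subRL _) //.
by case: ifP => // h'; case/negP: h; move: h'; lia.
Qed.

Lemma shiftC a b c a' b' c' (f : series) i j n :
  shift a b c (shift a' b' c' f) i j n = shift a' b' c' (shift a b c f) i j n.
Proof. by rewrite !shift_shift ![_ + a]addnC ![_ + b]addnC ![_ + c]addnC. Qed.

Lemma shiftD a b c (f g : series) i j n :
  shift a b c (fun i j n => f i j n + g i j n) i j n
  = shift a b c f i j n + shift a b c g i j n.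
Proof. by rewrite /shift; case: ifP. Qed.

Lemma shift_sum a b c I (s : seq I) (P : pred I) (f : I -> series) i j n :
  shift a b c (fun i j n => \sum_(k <- s | P k) f k i j n) i j n
  = \sum_(k <- s | P k) shift a b c (f k) i j n.
Proof. by rewrite /shift; case: ifP => // _; rewrite big1. Qed.

Lemma shift_small a b c (f : series) i j n : n < c -> shift a b c f i j n = 0.
Proof. by rewrite /shift => lt_nc; rewrite [c <= n]leqNgt lt_nc !andbF. Qed.

(** A step to some [k > n] already exceeds the degree, so any bound above [n] gives the same sum;
    this lets sums of different degrees share one range. *)
Lemma walksS r L a B i j n : n < B ->
  walks r L.+1 a i j n = \sum_(0 <= k < B | r a k) wshift k (walks r L k) i j n.
Proof.
move=> lt_nB; rewrite [RHS](big_cat_nat _ (n := n.+1)) //=.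
rewrite [X in _ + X]big_nat_cond [X in _ + X]big1 ?addn0 //.
by move=> k /andP[/andP[lt_nk _] _]; apply: shift_small.
Qed.

Lemma shift_walksS r L a c i j n :
  shift 0 0 c (walks r L.+1 a) i j n
  = \sum_(0 <= k < n.+1 | r a k) shift 0 0 c (wshift k (walks r L k)) i j n.
Proof.
rewrite -shift_sum; apply: eq_shift => i' j' m le_mn.
by apply: walksS; lia.
Qed.

(** * Walks under a periodic relation, and recurrences of series *)

Section Periodic.
Variables (r : rel nat) (p : nat).
Hypotheses (r_leq : forall a b, r a b -> a <= b).
Hypotheses (r_addn : forall a b, r (a + p) (b + p) = r a b) (p3 : 3 %| p).

Lemma wshift_addn k c (f : series) i j n :
  wshift (k + p) (shift 0 0 c f) i j n = shift 0 0 (p + c) (wshift k f) i j n.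
Proof.
have Dk: k + p = k %[mod 3] by rewrite -modnDmr (eqP p3) addn0.
by rewrite /wshift Dk !shift_shift !addn0 !add0n [p + c + k]addnC addnA.
Qed.

(** Lowering every one of the [L.+1] steps by [p] costs [p * L.+1] in degree and, as 3 divides [p],
    keeps the marks x and y. The translation law for length [L] is a hypothesis because the lemma
    serves inside the induction that proves this law as well as after it. *)
Lemma sum_shift a (P : pred nat) L i j n :
    (forall k i j n,
       walks r L (k + p) i j n = shift 0 0 (p * L) (walks r L k) i j n) ->
    (forall k, k < p -> P k = false) -> (forall k, P (k + p) = r a k) ->
  \sum_(0 <= k < n.+1 | P k) wshift k (walks r L k) i j n
  = shift 0 0 (p * L.+1) (walks r L.+1 a) i j n.
Proof.
move=> IH Plt Pge; rewrite shift_walksS.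
transitivity (\sum_(0 <= k < n.+1 + p | P k) wshift k (walks r L k) i j n).
  rewrite [RHS](big_cat_nat _ (n := n.+1)) ?leq_addr //=.
  rewrite [X in _ + X]big_nat_cond [X in _ + X]big1 ?addn0 //.
  by move=> k /andP[/andP[lt_nk _] _]; apply: shift_small.
rewrite (big_cat_nat _ (n := p)) ?leq_addl //=.
rewrite big_nat_cond big1 => [|k /andP[/andP[_ lt_kp]]]; last by rewrite Plt.
rewrite add0n -{1}[p]add0n big_addn addnK.
apply: eq_big => // k _; rewrite mulnS -wshift_addn.
by apply: eq_shift => *; apply: IH.
Qed.

Lemma walks_addn L a i j n :
  walks r L (a + p) i j n = shift 0 0 (p * L) (walks r L a) i j n.
Proof.
elim: L a i j n => [|L IH] a i j n; first by rewrite muln0 shift0.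
apply: (@sum_shift a (r (a + p))) => // k lt_kp.
by apply/negP => /r_leq; lia.
Qed.

(* The first step of a walk from a goes to a minimal b, or the walk is the
   translate by p of another walk from a. *)
Lemma walks_heads a (bs : seq nat) L i j n : uniq bs -> all (r a) bs ->
    (forall b, (p <= b) && r a (b - p) = r a b && (b \notin bs)) ->
  walks r L.+1 a i j n = \sum_(b <- bs) wshift b (walks r L b) i j n
                         + shift 0 0 (p * L.+1) (walks r L.+1 a) i j n.
Proof.
move=> Ubs /allP rbs Dr; rewrite /= (bigID (mem bs)) /=; congr (_ + _).
  rewrite [RHS](bigID (fun b => b < n.+1)) /= [X in _ = _ + X]big1 ?addn0.
    rewrite -big_filter -[RHS]big_filter; apply: perm_big.
    apply: uniq_perm; rewrite ?filter_uniq ?iota_uniq // => b.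
    rewrite !mem_filter mem_index_iota leq0n /=.
    by case: (boolP (b \in bs)) => [/rbs->|]; rewrite ?andbT ?andbF.
  by move=> b; rewrite -leqNgt; apply: shift_small.
rewrite -/(walks r L.+1 a); apply: sum_shift => [k i' j' m|k lt_kp|k].
- exact: walks_addn.
- by rewrite -Dr leqNgt lt_kp.
- by rewrite -Dr leq_addl addnK.
Qed.
End Periodic.

(** As [0 < c], the shifted term involves lower degrees only. This takes the place of a division by
    1 - q^c. *)
Lemma series_rec_uniq c (f g h : series) : 0 < c ->
    (forall i j n, f i j n = h i j n + shift 0 0 c f i j n) ->
    (forall i j n, g i j n = h i j n + shift 0 0 c g i j n) ->
  forall i j n, f i j n = g i j n.
Proof.
move=> c_gt0 Ef Eg i j n; elim/ltn_ind: n i j => n IH i j.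
rewrite Ef Eg; congr (_ + _); apply: eq_shift => i' j' m le_mn.
by apply: IH; lia.
Qed.

(* Multiplication by (1 + q^3)(1 + q^6)...(1 + q^(3 L)). *)
Fixpoint dist (L : nat) (f : series) : series := fun i j n =>
  if L is L'.+1 then dist L' f i j n + shift 0 0 (3 * L) (dist L' f) i j n
  else f i j n.

Lemma eq_dist L (f g : series) i j n :
    (forall i j m, m <= n -> f i j m = g i j m) ->
  dist L f i j n = dist L g i j n.
Proof.
elim: L i j n => [|L IH] i j n fg /=; first exact: fg.
rewrite IH //; congr (_ + _); apply: eq_shift => i' j' m le_mn.
by apply: IH => *; apply: fg; lia.
Qed.

Lemma dist_shift L a b c (f : series) i j n :
  dist L (shift a b c f) i j n = shift a b c (dist L f) i j n.
Proof.
elim: L i j n => //= L IH i j n; rewrite shiftD IH; congr (_ + _).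
by rewrite shiftC; apply: eq_shift => *; apply: IH.
Qed.

Lemma distD L (f g : series) i j n :
  dist L (fun i j n => f i j n + g i j n) i j n = dist L f i j n + dist L g i j n.
Proof.
elim: L i j n => //= L IH i j n; rewrite IH addnACA -shiftD.
by congr (_ + _); apply: eq_shift => *; apply: IH.
Qed.

Lemma dist_sum L I (s : seq I) (f : I -> series) i j n :
  dist L (fun i j n => \sum_(k <- s) f k i j n) i j n
  = \sum_(k <- s) dist L (f k) i j n.
Proof.
elim: L i j n => //= L IH i j n; rewrite IH big_split /=.
rewrite -(shift_sum _ _ _ s xpredT (fun k => dist L (f k))).
by congr (_ + _); apply: eq_shift => *; apply: IH.
Qed.

(** * The common recurrence from the starting points 0, 1, 5 *)

Definition adj_ascent : rel nat := fun a b => (a <= b) && adj_ok b a.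

Definition ascent (S : pred nat) : rel nat := fun a b => (a <= b) && S b.

Definition pm1_mod6 : pred nat := fun x => x %% 6 \in [:: 0; 1; 5].

Lemma adj_ascent_leq a b : adj_ascent a b -> a <= b.
Proof. by case/andP. Qed.

Lemma adj_ascent_addn3 a b : adj_ascent (a + 3) (b + 3) = adj_ascent a b.
Proof. by rewrite /adj_ascent /adj_ok modnDr leq_add2r !(addnAC a 3) !eqn_add2r. Qed.

Lemma ascent_leq S a b : ascent S a b -> a <= b.
Proof. by case/andP. Qed.

Lemma pm1_mod6_addn6 a b : ascent pm1_mod6 (a + 6) (b + 6) = ascent pm1_mod6 a b.
Proof. by rewrite /ascent /pm1_mod6 leq_add2r modnDr. Qed.

(** The steps from [a] that are not a period above another step from [a]. The same list serves
    period 3 for [adj_ascent] and period 6 for [ascent pm1_mod6]; the last branch is meant for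
    [a = 5]. *)
Definition heads (a : nat) : seq nat :=
  if a == 0 then [:: 0; 1; 5] else if a == 1 then [:: 1; 5; 6] else [:: 5; 6; 7].

Lemma adj_ascent_heads a b : a \in [:: 0; 1; 5] ->
  (3 <= b) && adj_ascent a (b - 3) = adj_ascent a b && (b \notin heads a).
Proof.
rewrite /adj_ascent /adj_ok !inE => /or3P[] /eqP-> /=; rewrite !inE; lia.
Qed.

Lemma pm1_mod6_heads a b : a \in [:: 0; 1; 5] ->
  (6 <= b) && ascent pm1_mod6 a (b - 6) = ascent pm1_mod6 a b && (b \notin heads a).
Proof.
rewrite /ascent /pm1_mod6 !inE => /or3P[] /eqP-> /=; rewrite !inE; lia.
Qed.

Lemma adj_ascent_dist L (a : nat) i j n : a \in [:: 0; 1; 5] ->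
  walks adj_ascent L a i j n = dist L (walks (ascent pm1_mod6) L a) i j n.
Proof.
elim: L a i j n => // L IH a i j n a015.
pose T := walks adj_ascent; pose H := walks (ascent pm1_mod6).
(* The heads 6 and 7 are translates of 0 and 1 by 6. This is a period of both relations, so both
   sides gain the same factor q^(6 L) and the induction hypothesis still applies. *)
have TH (b : nat) i' j' m : b \in heads a -> T L b i' j' m = dist L (H L b) i' j' m.
  move=> b_a; have: (b \in [:: 0; 1; 5]) || (b - 6 \in [:: 0; 1]) && (6 <= b).
    by move: a015 b_a; rewrite /heads !inE => /or3P[] /eqP-> /=; rewrite !inE; lia.
  case/orP=> [|/andP[b6 le6b]]; first exact: IH.
  have c6 x y: adj_ascent (x + 6) (y + 6) = adj_ascent x y.
    by rewrite -[6]/(3 + 3) !addnA !adj_ascent_addn3.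
  rewrite -(subnK le6b) /T (walks_addn adj_ascent_leq c6) //.
  rewrite (@eq_dist _ _ (shift 0 0 (6 * L) (H L (b - 6)))); last first.
    by move=> *; apply: (walks_addn (@ascent_leq _) pm1_mod6_addn6).
  rewrite dist_shift; apply: eq_shift => *; apply: IH.
  by move: b6; rewrite !inE => /orP[] ->; rewrite ?orbT.
have Uh: uniq (heads a) by move: a015; rewrite !inE => /or3P[] /eqP->.
have h_T: all (adj_ascent a) (heads a).
  by move: a015; rewrite !inE => /or3P[] /eqP->.
have h_H: all (ascent pm1_mod6 a) (heads a).
  by move: a015; rewrite !inE => /or3P[] /eqP->.
pose R : series := fun i j n =>
  \sum_(b <- heads a) wshift b (dist L (H L b)) i j n.
apply: (@series_rec_uniq (3 * L.+1) _ _ R) => // i' j' m.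
  have -> := walks_heads adj_ascent_leq adj_ascent_addn3 (dvdnn 3) L i' j' m Uh h_T
               (fun b => adj_ascent_heads b a015).
  congr (_ + _); rewrite /R !big_seq; apply: eq_bigr => b b_a.
  by apply: eq_shift => *; apply: TH.
(* Since (1 + q^(3 L + 3))(1 - q^(3 L + 3)) = 1 - q^(6 L + 6), the period 6 of
   the recurrence for H becomes the period 3 of the recurrence for T. *)
have EH i1 j1 n1 : dist L (H L.+1 a) i1 j1 n1
    = R i1 j1 n1 + shift 0 0 (6 * L.+1) (dist L (H L.+1 a)) i1 j1 n1.
  rewrite -dist_shift /R.
  under eq_bigr do rewrite /wshift -dist_shift.
  rewrite -dist_sum -distD; apply: eq_dist => *.
  exact: (walks_heads (@ascent_leq pm1_mod6) pm1_mod6_addn6 isT _ _ _ _ Uh h_H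
            (fun b => pm1_mod6_heads b a015)).
rewrite /= -/H {1}EH shiftD shift_shift addn0 -mulnDl -!addnA; congr (_ + _).
exact: addnC.
Qed.

(** * Nondecreasing walks and multisets of parts *)

Lemma eq_walks (D : pred nat) (r r' : rel nat) L a i j n :
    D a -> (forall x y, D x -> y <= n -> r x y = r' x y) ->
    (forall x y, D x -> r x y -> D y) ->
  walks r L a i j n = walks r' L a i j n.
Proof.
move=> Da rr' Dr; elim: L a i j n Da rr' => //= L IH a i j n Da rr'.
rewrite big_nat_cond [RHS]big_nat_cond; apply: eq_big => [k|k].
  by case: ltnP => //= le_kn; rewrite rr'.
case/andP=> /andP[_ le_kn] r_ak; apply: eq_shift => i' j' m le_mn.
apply: IH; first exact: Dr r_ak.
by move=> x y Dx le_ym; apply: rr' => //; lia.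
Qed.

Lemma eq_walks_ascent (S S' : pred nat) L a i j n :
    (forall x, a <= x <= n -> S x = S' x) ->
  walks (ascent S) L a i j n = walks (ascent S') L a i j n.
Proof.
move=> SS'; apply: (@eq_walks (leq a)) => // [x y le_ax le_yn | x y le_ax /andP[le_xy _]].
  by rewrite /ascent; case: leqP => //= le_xy; rewrite SS' // (leq_trans le_ax).
exact: leq_trans le_xy.
Qed.

Lemma walks_ascentS S L a B i j n : n < B -> a <= B ->
  walks (ascent S) L.+1 a i j n
  = \sum_(a <= k < B | S k) wshift k (walks (ascent S) L k) i j n.
Proof.
move=> lt_nB le_aB; rewrite (walksS _ _ _ _ _ lt_nB) (big_cat_nat _ (n := a)) //=.
rewrite big_nat_cond big1 => [|k /andP[/andP[_ lt_ka] /andP[]]]; last by lia.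
rewrite add0n big_nat_cond [RHS]big_nat_cond; apply: eq_bigl => k.
by rewrite /ascent; case: (a <= k).
Qed.

Lemma walks_ascent_peel S L a i j n :
  walks (ascent S) L.+1 a i j n
  = (if S a then wshift a (walks (ascent S) L a) i j n else 0)
    + walks (ascent S) L.+1 a.+1 i j n.
Proof.
have lt_n : n < (n + a).+1 by lia.
rewrite !(walks_ascentS _ _ _ _ lt_n) ?ltnS ?leq_addl // ?leqW ?leq_addl //.
by rewrite big_ltn_cond ?ltnS ?leq_addl //; case: ifP.
Qed.

(** Each of the [L] steps adds at least 1 to the degree. *)
Lemma walks_ascent_small S L a i j n :
  0 < a -> n < L -> walks (ascent S) L a i j n = 0.
Proof.
elim: L a i j n => // L IH a i j n a_gt0 lt_nL /=.
rewrite big1_seq // => k /andP[/andP[le_ak _]]; rewrite mem_index_iota => lt_kn.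
by rewrite /wshift /shift; case: ifP => // _; apply: IH; lia.
Qed.

Lemma walks_ascent_stable (S : pred nat) L i j n : S 0 -> n <= L ->
  walks (ascent S) L 0 i j n = walks (ascent S) n 0 i j n.
Proof.
move=> S0 /subnK <-; elim: (L - n) => // d IH.
rewrite addSn walks_ascent_peel S0 walks_ascent_small ?addn0; try lia.
by rewrite -IH; apply: shift0.
Qed.

(** Either [v] does not occur or one occurrence of it can be deleted. The double induction, on
    [v - a] and on [L], replaces the bijection by peeling off the steps to [a]. *)
Lemma walks_ascent_remove (S : pred nat) v L a i j n : S v -> a <= v ->
  walks (ascent S) L.+1 a i j n
  = walks (ascent [pred x | S x & x != v]) L.+1 a i j n
    + wshift v (walks (ascent S) L a) i j n.
Proof.
move=> Sv; set S' := [pred x | S x & x != v]; have [d] := ubnP (v - a).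
have S'E x : S' x = S x && (x != v) by [].
elim: d L a i j n => // d IHd L; elim: L => [|L IHL] a i j n lt_d le_av.
all: rewrite walks_ascent_peel [in RHS]walks_ascent_peel S'E.
all: have [->|neq_av] := eqVneq a v.
(* When [a = v], the peeled term is the deleted occurrence, and [S] and [S'] agree beyond [v]. *)
1,3: rewrite Sv andbF add0n addnC; congr (_ + _); apply: eq_walks_ascent => x.
1,2: by move=> /andP[lt_vx _]; rewrite S'E neq_ltn lt_vx orbT andbT.
  rewrite andbT -addnA; congr (_ + _).
  by rewrite IHd //; lia.
rewrite andbT IHd; try lia.
(* Peeling the last term at [a] too splits the claim into an instance with shorter walks, for [IHL],
   and one with start [a.+1], settled by [IHd]. *)
have -> : wshift v (walks (ascent S) L.+1 a) i j n
    = (if S a then wshift v (wshift a (walks (ascent S) L a)) i j n else 0)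
      + wshift v (walks (ascent S) L.+1 a.+1) i j n.
  case Sa: (S a); last first.
    by apply: eq_shift => *; rewrite walks_ascent_peel Sa.
  by rewrite -shiftD; apply: eq_shift => *; rewrite walks_ascent_peel Sa.
case: (S a); last by rewrite !add0n.
rewrite addnACA; congr (_ + _).
rewrite [X in _ + X]shiftC -shiftD; apply: eq_shift => *.
by rewrite IHL.
Qed.

(* All multisets of positive elements of S, provided that S contains 0: a walk
   of length n is then such a multiset padded by zeros. *)
Definition multisets (S : pred nat) : series := fun i j n =>
  walks (ascent S) n 0 i j n.

Lemma multisets_remove (S : pred nat) v i j n : S 0 -> S v -> 0 < v ->
  multisets S i j n
  = multisets [pred x | S x & x != v] i j n + wshift v (multisets S) i j n.
Proof.
move=> S0 Sv v_gt0; rewrite {1}/multisets -(walks_ascent_stable _ _ S0 (leqnSn n)).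
rewrite (walks_ascent_remove _ _ _ _ Sv (leq0n v)); congr (_ + _).
  by apply: walks_ascent_stable; rewrite //= S0 eq_sym -lt0n.
by apply: eq_shift => *; apply: walks_ascent_stable => //; lia.
Qed.

(* (1 + q^w) / (1 - q^(2 w)) = 1 / (1 - q^w) *)
Lemma multisets_halve (S S' : pred nat) w i j n :
    S 0 -> S' 0 -> 0 < w -> 3 %| w -> S (2 * w) -> S' w ->
    [pred x | S x & x != 2 * w] =1 [pred x | S' x & x != w] ->
  multisets S' i j n = multisets S i j n + shift 0 0 w (multisets S) i j n.
Proof.
move=> S0 S'0 w_gt0 w3 Sw S'w SS'.
have wshift3 v f i' j' n' : 3 %| v -> wshift v f i' j' n' = shift 0 0 v f i' j' n'.
  by rewrite /wshift => /eqP->.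
pose g i j n := multisets S i j n + shift 0 0 w (multisets S) i j n.
have w2_3 : 3 %| 2 * w by rewrite dvdn_mull.
have w2_gt0 : 0 < 2 * w by lia.
apply: (@series_rec_uniq w _ g (multisets [pred x | S x & x != 2 * w])) => //.
  move=> i' j' m; rewrite (multisets_remove _ _ _ S'0 S'w w_gt0) wshift3 //.
  by congr (_ + _); apply: eq_walks_ascent => x _; rewrite SS'.
move=> i' j' m; rewrite /g shiftD shift_shift !addn0 addnn -mul2n.
rewrite {1}(multisets_remove _ _ _ S0 Sw w2_gt0) wshift3 //.
rewrite -!addnA; congr (_ + _).
exact: addnC.
Qed.

(* The multiples of 3 are 3, 6, ..., 3 m and 6 (m + 1), 6 (m + 2), ... *)
Definition euler_parts (m : nat) : pred nat := fun x =>
  if 3 %| x then (x <= 3 * m) || (6 %| x) && (6 * m < x) else x %% 6 \in [:: 1; 5].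

Lemma multisets_euler m i j n :
  multisets (euler_parts m) i j n = dist m (multisets pm1_mod6) i j n.
Proof.
elim: m i j n => [|m IH] i j n.
  apply: eq_walks_ascent => x _; by rewrite /euler_parts /pm1_mod6 !inE; case: ifP; lia.
rewrite (@multisets_halve (euler_parts m) _ (3 * m.+1)) //=.
- by rewrite IH; congr (_ + _); apply: eq_shift => *; apply: IH.
- by rewrite dvdn_mulr.
- by rewrite /euler_parts; case: ifP; lia.
- by rewrite /euler_parts; case: ifP; lia.
by move=> x; rewrite /euler_parts /=; case: ifP; lia.
Qed.

Definition mod6_0135 : pred nat := fun x => x %% 6 \in [:: 0; 1; 3; 5].

Lemma adj_ascent_mod6 i j n :
  walks adj_ascent n 0 i j n = walks (ascent mod6_0135) n 0 i j n.
Proof.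
rewrite adj_ascent_dist //.
rewrite (@eq_dist _ _ (multisets pm1_mod6)); last first.
  by move=> *; apply: walks_ascent_stable.
(* With [m = n], every multiple of 3 up to [n] satisfies [x <= 3 * m], so the limit is already
   reached in degree [n]. *)
rewrite -multisets_euler; apply: eq_walks_ascent => x /andP[_ le_xn].
by rewrite /euler_parts /mod6_0135 !inE; case: ifP; lia.
Qed.

(** * Partitions as walks *)

Definition weight (i j n : nat) (s : seq nat) : bool :=
  [&& count (fun x => x %% 3 == 1) s == i, count (fun x => x %% 3 == 2) s == j
    & sumn s == n].

Lemma weight_cons i j n x s : weight i j n (x :: s)
  = [&& x %% 3 == 1 <= i, x %% 3 == 2 <= j & x <= n]
    && weight (i - (x %% 3 == 1)) (j - (x %% 3 == 2)) (n - x) s.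
Proof. by rewrite /weight /=; lia. Qed.

(** The bound [N] on the entries stays fixed while the remaining degree [n] drops along the walk. *)
Lemma card_walks (r : rel nat) N L a i j n : n <= N ->
  #|[set t : L.-tuple 'I_N.+1 | path r a (map (@nat_of_ord _) t)
       && weight i j n (map (@nat_of_ord _) t)]| = walks r L a i j n.
Proof.
rewrite -sum1dep_card big_mkcond /=.
elim: L a i j n => [|L IH] a i j n le_nN.
  rewrite (big_pred1 [tuple]) => [|t]; last by apply/esym/eqP; exact: tuple0.
  by rewrite /weight /= ![0 == _]eq_sym; case: ifP.
rewrite (@walksS _ _ _ N.+1) // big_mkord [RHS]big_mkcond.
rewrite (reindex (fun p : 'I_N.+1 * L.-tuple 'I_N.+1 =>
  [tuple of p.1 :: p.2])) /=; last first.
  exists (fun t => (thead t, [tuple of behead t])) => [[x t] _ | t _] /=.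
    by congr (_, _); apply: val_inj.
  by rewrite -tuple_eta.
rewrite -(pair_bigA _ (fun x (t : L.-tuple _) =>
  if path r a (map (@nat_of_ord _) (x :: t))
     && weight i j n (map (@nat_of_ord _) (x :: t)) then 1 else 0)) /=.
apply: eq_bigr => x _.
case r_ax: (r a x); last by rewrite big1.
rewrite /wshift /shift.
under eq_bigr do rewrite weight_cons.
case: ifP => _; last by rewrite big1 // => t _; rewrite andbF.
by rewrite -IH //; lia.
Qed.

Definition positive (r : rel nat) : rel nat := fun a b => r a b && (0 < b).

(** The zeros of a nondecreasing walk come first; [k] counts the steps left after them. *)
Lemma walks_positive (r : rel nat) L i j n :
    r 0 0 -> (forall a b, r a b -> a <= b) ->
  walks r L 0 i j n = \sum_(k < L.+1) walks (positive r) k 0 i j n.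
Proof.
move=> r00 r_leq; elim: L i j n => [|L IH] i j n; first by rewrite big_ord1.
rewrite big_ord_recr /= -IH.
rewrite big_ltn_cond // [X in _ = _ + X]big_ltn_cond // r00 /positive r00 /=.
congr (_ + _); first exact: shift0.
rewrite big_nat_cond [RHS]big_nat_cond; apply: eq_big => [k|k].
  by case: k => //= k; rewrite andbT.
case/andP=> /andP[k_gt0 _] _; apply: eq_shift => i' j' m _.
(* After a positive step the walk stays positive, so [r] and [positive r] agree from there on. *)
apply: (@eq_walks (leq 1)) => // [x y x_gt0 _|x y x_gt0 /r_leq]; last exact: leq_trans.
by case r_xy: (r x y) => //=; rewrite (leq_trans x_gt0) ?r_leq.
Qed.

Lemma npart_walks (r : rel nat) (Q : pred (seq nat)) i j n :
    r 0 0 -> (forall a b, r a b -> a <= b) ->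
    (forall s, is_partition n (rev s) && Q (rev s)
               = path (positive r) 0 s && weight i j n s) ->
  npart Q n = walks r n 0 i j n.
Proof.
move=> r00 r_leq QE; rewrite walks_positive //; apply: eq_bigr => k _.
rewrite -(card_walks _ _ _ _ _ (leqnn n)) -!sum1dep_card.
rewrite (reindex_inj (h := fun t : k.-tuple 'I_n.+1 => [tuple of rev t])) /=; last first.
  by move=> t1 t2 /(congr1 val) /(can_inj revK) /val_inj.
by apply: eq_bigl => t; rewrite map_rev QE.
Qed.

(** From a positive start other than 2, the value 2 could first be reached only from 1, which
    condition (a) forbids; so [2 \notin s] comes for free. *)
Lemma path_positive_adj_ascent a s : 0 < a -> a != 2 ->
  path (positive adj_ascent) a s
  = [&& path leq a s, path (fun x y => adj_ok y x) a s, all (fun x => 0 < x) s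
      & 2 \notin s].
Proof.
elim: s a => //= b s IH a a_gt0 a_neq2; rewrite /positive /adj_ascent inE.
have [->|b_neq2] := eqVneq b 2.
  rewrite /= !andbF; apply/negP => /andP[/andP[/andP[le_a2]]].
  by have -> : a = 1 by lia.
case: (posnP b) => [->|b_gt0]; first by rewrite !andbF.
by rewrite IH //= andbT -!andbA; do !bool_congr.
Qed.

Lemma path_positive_ascent S a s :
  path (positive (ascent S)) a s
  = [&& path leq a s, all S s & all (fun x => 0 < x) s].
Proof.
elim: s a => //= b s IH a; rewrite IH /positive /ascent.
by rewrite -!andbA; do !bool_congr.
Qed.

Lemma C2_walks m1 m2 n : C2 m1 m2 n = walks adj_ascent n 0 m1 m2 n.
Proof.
apply: npart_walks => // [|s]; first exact: adj_ascent_leq.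
rewrite /is_partition /C2_pred /weight !rev_sorted all_rev sumn_rev mem_rev !count_rev.
case: s => [|b s] /=; first by do !bool_congr.
rewrite {1}/positive /adj_ascent /= inE.
have [->|b_gt0] := posnP b; first by rewrite !andbF.
(* The step from the starting point 0 to 2 violates condition (b), so (c) is encoded by starting at
   0. *)
have [->|b_neq2] := eqVneq b 2; first by rewrite /= !andbF.
rewrite path_positive_adj_ascent //.
have -> : adj_ok b 0 by rewrite /adj_ok; lia.
by rewrite /= -!andbA; do !bool_congr.
Qed.

Lemma C1_walks m1 m2 n : C1 m1 m2 n = walks (ascent mod6_0135) n 0 m1 m2 n.
Proof.
apply: npart_walks => // [|s]; first exact: ascent_leq.
rewrite /is_partition /C1_pred /weight !rev_sorted !all_rev sumn_rev !count_rev.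
rewrite path_positive_ascent path_min_sorted; last exact/allP.
rewrite -[all (fun x => x %% 6 \in _) s]/(all mod6_0135 s).
have [S_s|_] := boolP (all mod6_0135 s); last by rewrite !(andbF, andFb).
(* Among the residues 0, 1, 3, 5 mod 6, only 1 is 1 mod 3 and only 5 is 2 mod 3. *)
have mod3 b c : (forall x, mod6_0135 x -> (x %% 3 == b) = (x %% 6 == c)) ->
    count (fun x => x %% 3 == b) s = count (fun x => x %% 6 == c) s.
  by move=> bc; apply: eq_in_count => x /(allP S_s); apply: bc.
rewrite (mod3 1 1) ?(mod3 2 5); try by move=> x; rewrite /mod6_0135 !inE; lia.
by rewrite /= -!andbA; do !bool_congr.
Qed.

Theorem theorem3p3 (n m1 m2 : nat) : C1 m1 m2 n = C2 m1 m2 n.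
Proof. by rewrite C1_walks C2_walks adj_ascent_mod6. Qed.
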